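(* Let $\Delta=\operatorname{conv}\{\alpha(0),\alpha(1),\alpha(2)\}\subset\mathbb{R}^2$ be a two-dimensional lattice simplex with $\alpha(0),\alpha(1),\alpha(2)\in(2\mathbb{N})^2$ such that $\frac12\Delta$ has at least four boundary lattice points. Then $\Delta$ is an $H$-simplex.
   Context: $\mathbb{N}=\{0,1,2,\dots\}$. Let $\hat\Delta$ be the vertex set of $\Delta$. For $L\subseteq\Delta\cap\mathbb{Z}^2$ put $\overline{A}(L)=\{\tfrac12(s+t)\in\mathbb{Z}^2: s\ne t,\ s,t\in L\cap(2\mathbb{Z})^2\}$. $L$ is $\hat\Delta$-mediated if $\hat\Delta\subseteq L\subseteq\overline{A}(L)\cup\hat\Delta$. $\Delta^*$ denotes the (unique) maximal $\hat\Delta$-mediated set, which contains every $\hat\Delta$-mediated set. $\Delta$ is an $H$-simplex if $\Delta^*=\Delta\cap\mathbb{Z}^2$, i.e. every lattice point of $\Delta$ other than the vertices is the midpoint of two distinct even lattice points of $\Delta$. *)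

(* Defs.v *)
From HB Require Import structures.
From mathcomp Require Import all_boot all_order all_algebra.
From mathcomp Require Import all_classical all_reals all_analysis.

Set Implicit Arguments.
Unset Strict Implicit.
Unset Printing Implicit Defensive.

Import Order.TTheory GRing.Theory Num.Theory.
Import numFieldNormedType.Exports.

Local Open Scope classical_set_scope.
Local Open Scope ring_scope.

Definition conv_hull (R : realType) (n : nat) (V : set 'rV[R]_n) :
    set 'rV[R]_n :=
  smallest (@convex_set R 'rV[R]_n) V.

Definition lattice (R : realType) (n : nat) : set 'rV[R]_n :=
  range (fun z : 'rV[int]_n => map_mx intr z).
Arguments lattice : clear implicits.

Definition even_lattice (R : realType) (n : nat) : set 'rV[R]_n :=
  [set 2 *: x | x in lattice R n].
Arguments even_lattice : clear implicits.

Definition even_nat_lattice (R : realType) (n : nat) : set 'rV[R]_n :=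
  range (fun k : 'rV[nat]_n => 2 *: map_mx (fun m : nat => m%:R) k).
Arguments even_nat_lattice : clear implicits.

Definition boundary (T : topologicalType) (A : set T) : set T :=
  closure A `\` interior A.

(* The set written \overline{A}(L). *)
Definition even_midpoints (R : realType) (n : nat) (L : set 'rV[R]_n) :
    set 'rV[R]_n :=
  [set x | lattice R n x /\
    exists s t, [/\ s <> t, (L `&` even_lattice R n) s,
                    (L `&` even_lattice R n) t & x = 2^-1 *: (s + t)]].

(* V is the vertex set of the simplex conv_hull V. *)
Definition mediated (R : realType) (n : nat) (V L : set 'rV[R]_n) : Prop :=
  [/\ L `<=` conv_hull V `&` lattice R n,
      V `<=` L & L `<=` even_midpoints L `|` V].

(* The union of all V-mediated sets; max_mediatedP shows that it is itself
   V-mediated, hence the largest such set. *)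
Definition max_mediated (R : realType) (n : nat) (V : set 'rV[R]_n) :
    set 'rV[R]_n :=
  \bigcup_(L in [set L | mediated V L]) L.

Lemma max_mediatedP (R : realType) (n : nat) (V : set 'rV[R]_n) :
  V `<=` lattice R n ->
  mediated V (max_mediated V) /\
  (forall L, mediated V L -> L `<=` max_mediated V).
Proof.
move=> VZ; split; last by move=> L mL x Lx; exists L.
have mV : mediated V V.
  split=> [x Vx|//|]; last exact: subsetUr.
  by split; [exact: sub_gen_smallest | exact: VZ].
split=> [x [L [LZ _ _] Lx]|x Vx|x [L mL Lx]]; first exact: LZ.
  by exists V.
have [_ _ LA] := mL.
have [[xZ [s [t [st [Ls s2] [Lt t2] xst]]]]|Vx] := LA x Lx; last by right.
by left; split=> //; exists s, t; split=> //; split=> //; exists L.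
Qed.

Definition H_simplex (R : realType) (n : nat) (V : set 'rV[R]_n) : Prop :=
  max_mediated V = conv_hull V `&` lattice R n.

(* The affine dimension of the convex hull of a 0, ..., a m. *)
Definition affine_dim (R : realType) (n m : nat) (a : 'I_m.+1 -> 'rV[R]_n) :
    nat :=
  \rank (\matrix_(i < m.+1) (a i - a ord0)).

(* Main.v *)
Require Import Defs.
From mathcomp Require Import all_boot all_order all_algebra.
From mathcomp Require Import all_classical all_reals all_analysis.
From mathcomp Require Import ring zify.
Import Order.TTheory GRing.Theory Num.Theory.
Import numFieldNormedType.Exports.
Local Open Scope card_scope.
Local Open Scope classical_set_scope.
Local Open Scope ring_scope.

(** Put T = Delta / 2, a lattice triangle with vertices p, q, r.  Halving turns
    the even lattice points of Delta into the lattice points of T, so Delta is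
    an H-simplex as soon as every lattice point x of 2T other than 2p, 2q, 2r
    is a sum of two distinct lattice points of T.

    A decomposition x = s + t with s, t in T always exists: a lattice triangle
    of normalized area at least 2 contains a lattice point besides its vertices
    ([triangle_point]), which cuts it into smaller triangles, and one of them
    still contains x / 2.  The descent stops at a unimodular triangle, where the
    barycentric coordinates of x / 2 are half-integers ([triangle_idp]).

    The remaining case is x = 2s, with s a lattice point of T that is not a
    vertex; some g <> 0 is needed with s + g and s - g in T
    ([nonvertex_midpoint]).  If s lies on an edge, take for g the primitive
    vector along that edge ([opposite_antipodal]).  If s is interior, move it
    to the origin.  Shrinking the triangle around the origin produces either
    such a g or lattice points u, v, w of T with all pairwise determinants 1,
    hence u + v + w = 0 ([unimodular_around]).  A lattice point a u + b v of T
    with a, b > 0 forces u + v = - w into T, and then g = w works; the same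
    holds for the pairs v, w and w, u.  In the absence of such points every
    nonzero lattice point of T lies on one of the rays spanned by u, v, w.
    A ray from an interior point meets the boundary only once, so T would have
    at most three boundary lattice points, against the hypothesis of four
    ([four_supporting_antipodal]).

    The rest identifies the convex hull of three points with the intersection
    of three half-planes, which shows that a boundary point lies on an edge
    line, and carries the integer statement over to the reals. *)

(** * Determinants in the plane *)

Definition cross (R : pzRingType) (u v : 'rV[R]_2) : R :=
  u 0 0 * v 0 1 - u 0 1 * v 0 0.

(** Twice the signed area of the triangle p, q, x. *)
Definition side (R : pzRingType) (p q x : 'rV[R]_2) : R :=
  cross _ (q - p) (x - p).

Arguments cross {R} u v.
Arguments side {R} p q x.

Lemma rV2P (R : Type) (u v : 'rV[R]_2) :
  u 0 0 = v 0 0 -> u 0 1 = v 0 1 -> u = v.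
Proof.
move=> e0 e1; apply/rowP => i.
have [->|->] // : i = 0 \/ i = 1.
by case: i => -[|[|//]] ?; [left | right]; apply: val_inj.
Qed.

Ltac crossring := rewrite /side /cross ?mxE; ring.
Ltac vecring := apply: rV2P; crossring.

Lemma cramer (R : comPzRingType) (u v w : 'rV[R]_2) :
  cross u v *: w = cross w v *: u + cross u w *: v.
Proof. vecring. Qed.

Lemma barycentric (R : comPzRingType) (p q r x : 'rV[R]_2) :
  side p q r *: x = side q r x *: p + side r p x *: q + side p q x *: r.
Proof. vecring. Qed.

Lemma side_sum (R : comPzRingType) (p q r x : 'rV[R]_2) :
  side q r x + side r p x + side p q x = side p q r.
Proof. crossring. Qed.

Lemma scale_rV_inj (R : idomainType) (c : R) (u v : 'rV[R]_2) :
  c != 0 -> c *: u = c *: v -> u = v.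
Proof.
move=> c0 /rowP E; apply/rowP => i; apply: (mulfI c0).
by have := E i; rewrite !mxE.
Qed.

Definition triangle (R : numDomainType) (p q r : 'rV[R]_2) : set 'rV[R]_2 :=
  [set x | [/\ 0 <= side p q x, 0 <= side q r x & 0 <= side r p x]].
Arguments triangle {R} p q r.

Lemma side_left (R : comPzRingType) (p q : 'rV[R]_2) : side p q p = 0.
Proof. by crossring. Qed.

Lemma side_right (R : comPzRingType) (p q : 'rV[R]_2) : side p q q = 0.
Proof. by crossring. Qed.

Lemma triangle_vertices (R : numDomainType) (p q r : 'rV[R]_2) :
  0 < side p q r ->
  [/\ triangle p q r p, triangle p q r q & triangle p q r r].
Proof.
move=> /ltW D0.
have rot : side q r p = side p q r by crossring.
have rot' : side r p q = side p q r by crossring.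
by rewrite /triangle /= !side_left !side_right rot rot'.
Qed.

(** * Lattice-convex sets *)

(** The trace of convexity on the lattice, phrased without leaving the integers.
    Barycenters of three points are enough to reach the lattice points of a
    triangle. *)
Definition lattice_convex (K : set 'rV[int]_2) :=
  forall (a b c : int) (u v w p : 'rV[int]_2),
  0 <= a -> 0 <= b -> 0 <= c -> 0 < a + b + c ->
  (a + b + c) *: p = a *: u + b *: v + c *: w ->
  K u -> K v -> K w -> K p.

Lemma lattice_convex_triangle (p q r : 'rV[int]_2) :
  lattice_convex (triangle p q r).
Proof.
move=> a b c u v w x a0 b0 c0 abc E [u1 u2 u3] [v1 v2 v3] [w1 w2 w3].
have half (y z : 'rV[int]_2) : 0 <= side y z u -> 0 <= side y z v ->
    0 <= side y z w -> 0 <= side y z x.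
  move=> U V W; rewrite -(pmulr_rge0 _ abc).
  have -> : (a + b + c) * side y z x =
      cross (z - y) ((a + b + c) *: x - (a + b + c) *: y) by crossring.
  rewrite E; have -> : cross (z - y)
      (a *: u + b *: v + c *: w - (a + b + c) *: y) =
      a * side y z u + b * side y z v + c * side y z w by crossring.
  by rewrite !addr_ge0 // mulr_ge0.
by split; apply: half.
Qed.

Lemma lattice_convex_translate (K : set 'rV[int]_2) (s : 'rV[int]_2) :
  lattice_convex K -> lattice_convex [set p | K (s + p)].
Proof.
move=> cK a b c u v w p a0 b0 c0 abc E Ku Kv Kw.
apply: (cK a b c _ _ _ _ a0 b0 c0 abc _ Ku Kv Kw).
by rewrite !scalerDr E !scalerDl !addrA; apply: rV2P; rewrite !mxE; ring.
Qed.

Definition antipodal (K : set 'rV[int]_2) :=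
  exists g, [/\ g != 0, K g & K (- g)].

(** With u = k g and g primitive, v is an integral multiple e g with e < 0, so
    g and - g both lie on the segment from e g to k g. *)
Lemma opposite_antipodal (K : set 'rV[int]_2) (u v : 'rV[int]_2) (m n : int) :
  lattice_convex K -> K u -> K v -> u != 0 -> 0 < m -> 0 < n ->
  m *: u + n *: v = 0 -> antipodal K.
Proof.
move=> cK Ku Kv u0 m0 n0 E.
have E0 : m * u 0 0 + n * v 0 0 = 0 by have /rowP/(_ 0) := E; rewrite !mxE.
have E1 : m * u 0 1 + n * v 0 1 = 0 by have /rowP/(_ 1) := E; rewrite !mxE.
set k := gcdz (u 0 0) (u 0 1).
have k0 : 0 < k.
  rewrite lt0r gcdz_eq0 /k /gcdz; apply/andP; split=> //.
  apply: contra u0 => /andP[/eqP e0 /eqP e1]; apply/eqP.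
  by apply: rV2P; rewrite mxE.
have [g0 g0E] : exists g0, u 0 0 = g0 * k by apply/dvdzP/dvdz_gcdl.
have [g1 g1E] : exists g1, u 0 1 = g1 * k by apply/dvdzP/dvdz_gcdr.
have [a [b ab]] := Bezoutz (u 0 0) (u 0 1).
pose g : 'rV[int]_2 := \row_j (if j == 0 then g0 else g1).
have ug : u = k *: g by apply: rV2P; rewrite !mxE /= mulrC.
rewrite -/k in ab.
have ab1 : a * g0 + b * g1 = 1.
  apply: (mulIf (lt0r_neq0 k0)); rewrite mul1r -[RHS]ab g0E g1E; ring.
pose e := a * v 0 0 + b * v 0 1.
have ke : m * k + n * e = 0.
  have : a * (m * u 0 0 + n * v 0 0) + b * (m * u 0 1 + n * v 0 1) = 0.
    by rewrite E0 E1 !mulr0 addr0.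
  move=> <-; rewrite -ab /e; ring.
have e0 : e < 0 by nia.
have gv : g0 * v 0 1 - g1 * v 0 0 = 0.
  have : n * k * (g0 * v 0 1 - g1 * v 0 0) = 0.
    have : u 0 0 * (m * u 0 1 + n * v 0 1) -
        u 0 1 * (m * u 0 0 + n * v 0 0) = 0 by rewrite E0 E1 !mulr0 subr0.
    by rewrite g0E g1E => <-; ring.
  by move=> /eqP; rewrite !mulf_eq0 => /orP[/orP[]|] /eqP; lia.
have ve : v = e *: g.
  apply: rV2P; rewrite !mxE /= /e.
    rewrite -[LHS]mulr1 -ab1; apply/eqP; rewrite -subr_eq0; apply/eqP.
    by rewrite -[RHS](mulr0 (- b)) -gv; ring.
  rewrite -[LHS]mulr1 -ab1; apply/eqP; rewrite -subr_eq0; apply/eqP.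
  by rewrite -[RHS](mulr0 a) -gv; ring.
exists g; split.
- by apply: contra u0 => /eqP g00; rewrite ug g00 scaler0.
- apply: (cK (1 - e) (k - 1) 0 u v v) => //; try lia.
  by rewrite ug ve; vecring.
- apply: (cK (-1 - e) (k + 1) 0 u v v) => //; try lia.
  by rewrite ug ve; vecring.
Qed.

(** * Lattice points in triangles of area at least 2 *)

(** If the determinant d divided all Cramer coordinates of the unit vectors,
    then d ^ 2 would divide det (e0, e1) * d = d. *)
Lemma lattice_point_outside (u v : 'rV[int]_2) : 1 < cross u v ->
  exists e, ~~ ((cross u v %| cross e v)%Z && (cross u v %| cross u e)%Z).
Proof.
move=> d1.
pose e0 : 'rV[int]_2 := delta_mx 0 0; pose e1 : 'rV[int]_2 := delta_mx 0 1.
have [d0|] := boolP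
  ((cross u v %| cross e0 v)%Z && (cross u v %| cross u e0)%Z); last by exists e0.
have [d2|] := boolP
  ((cross u v %| cross e1 v)%Z && (cross u v %| cross u e1)%Z); last by exists e1.
exfalso.
have E : cross e0 v * cross u e1 - cross e1 v * cross u e0 = cross u v.
  by rewrite /cross !mxE /=; ring.
case/andP: d0 => /dvdzP[a0 a0E] /dvdzP[b0 b0E].
case/andP: d2 => /dvdzP[a1 a1E] /dvdzP[b1 b1E].
move: E; rewrite a0E b0E a1E b1E; move: (cross u v) d1 => d d1 E.
have : d * (a0 * b1 - a1 * b0) = 1.
  have : d * (d * (a0 * b1 - a1 * b0) - 1) = 0.
    have -> : d * (d * (a0 * b1 - a1 * b0) - 1) =
      a0 * d * (b1 * d) - a1 * d * (b0 * d) - d by ring.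
    by rewrite E subrr.
  by move/eqP; rewrite mulf_eq0 => /orP[] /eqP; lia.
by move: (a0 * b1 - a1 * b0) => m; have [|] := leP m 0; nia.
Qed.

(** Reduce the Cramer coordinates of a point off the lattice spanned by u and v
    modulo d; this gives a point of the half-open parallelogram, and its
    reflection u + v - q lies in the triangle 0, u, v when q does not. *)
Lemma empty_triangle_point (u v : 'rV[int]_2) : 1 < cross u v ->
  exists q, [/\ 0 <= cross q v < cross u v, 0 <= cross u q < cross u v &
     0 < cross q v + cross u q <= cross u v].
Proof.
move=> d1; have [e eP] := lattice_point_outside _ _ d1.
set d := cross u v in d1 eP *.
pose q := e - (cross e v %/ d)%Z *: u - (cross u e %/ d)%Z *: v.
have qv : cross q v = (cross e v %% d)%Z.
  rewrite /modz -/d /q /d; crossring.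
have uq : cross u q = (cross u e %% d)%Z.
  rewrite /modz -/d /q /d; crossring.
have m0 (x : int) : 0 <= (x %% d)%Z < d.
  by rewrite modz_ge0 ?ltz_pmod //; lia.
have := m0 (cross e v); have := m0 (cross u e); rewrite -qv -uq => b a.
have nz : 0 < cross q v + cross u q.
  have [s0|//] := leP (cross q v + cross u q) 0.
  by case/negP: eP; apply/andP; split; apply/dvdz_mod0P; rewrite -?qv -?uq; lia.
have [le|gt] := leP (cross q v + cross u q) d.
  by exists q; rewrite a b nz le.
have q'v : cross (u + v - q) v = d - cross q v by rewrite /d; crossring.
have uq' : cross u (u + v - q) = d - cross u q by rewrite /d; crossring.
by exists (u + v - q); rewrite q'v uq'; split; lia.
Qed.

Lemma triangle_point (p q r : 'rV[int]_2) : 1 < side p q r ->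
  exists m, [/\ 0 <= side q r m < side p q r, 0 <= side r p m < side p q r &
    0 <= side p q m < side p q r].
Proof.
rewrite -[q](subrKC p) -[r](subrKC p); move: (q - p) (r - p) => u v.
have -> : side p (p + u) (p + v) = cross u v by crossring.
move=> /empty_triangle_point[y [yv uy sy]]; exists (p + y).
have -> : side (p + u) (p + v) (p + y) = cross u v - cross y v - cross u y.
  by crossring.
have -> : side (p + v) p (p + y) = cross y v by crossring.
have -> : side p (p + u) (p + y) = cross u y by crossring.
by split; lia.
Qed.

(** * Lattice points of the doubled triangle *)

(** Some index i with q_i > 0 minimizes c_i / q_i.  When c and q are barycentric
    coordinates of two points, the triangle obtained by replacing the i-th
    vertex with the second point contains the first one. *)
Lemma min_ratio (c1 c2 c3 q1 q2 q3 : int) :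
  0 <= c1 -> 0 <= c2 -> 0 <= c3 -> 0 <= q1 -> 0 <= q2 -> 0 <= q3 ->
  0 < q1 + q2 + q3 ->
  [\/ [/\ 0 < q1, c1 * q2 <= c2 * q1 & c1 * q3 <= c3 * q1],
      [/\ 0 < q2, c2 * q1 <= c1 * q2 & c2 * q3 <= c3 * q2] |
      [/\ 0 < q3, c3 * q1 <= c1 * q3 & c3 * q2 <= c2 * q3]].
Proof.
have two (c d q r : int) : 0 <= c -> 0 <= d -> 0 <= q -> 0 <= r -> 0 < q + r ->
    (0 < q /\ c * r <= d * q) \/ (0 < r /\ d * q <= c * r).
  move=> c0 d0 q0 r0 qr; have [le|lt] := leP (c * r) (d * q).
    have [?|?] := leP q 0; last by left.
    have ? : q = 0 by lia.
    by subst q; right; split; [lia | nia].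
  by right; split; nia.
have trans (c d e q r s : int) : 0 < q -> 0 <= r -> 0 <= s ->
    c * q <= e * s -> e * r <= d * q -> c * r <= d * s.
  move=> q0 r0 s0 H1 H2; rewrite -(ler_pM2r q0).
  have : c * q * r <= e * s * r by apply: ler_wpM2r.
  have : e * r * s <= d * q * s by apply: ler_wpM2r.
  lia.
move=> c10 c20 c30 q10 q20 q30 Q.
have [z|nz] := leP (q1 + q2) 0.
  have -> : q1 = 0 by lia.
  have -> : q2 = 0 by lia.
  by apply: Or33; split; nia.
have [[p le]|[p le]] := two c1 c2 q1 q2 c10 c20 q10 q20 nz.
- have [[p' le']|[p' le']] := two c1 c3 q1 q3 c10 c30 q10 q30 ltac:(lia).
    by apply: Or31.
  apply: Or33; split=> //; exact: (trans _ _ c1 q1).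
- have [[p' le']|[p' le']] := two c2 c3 q2 q3 c20 c30 q20 q30 ltac:(lia).
    by apply: Or32.
  apply: Or33; split=> //; exact: (trans _ _ c2 q2).
Qed.

(** The side of x / 2 with respect to the line p q, doubled to stay integral. *)
Definition side2 (p q x : 'rV[int]_2) : int := cross (q - p) (x - 2 *: p).

Lemma unimodular_idp (K : set 'rV[int]_2) (p q r x : 'rV[int]_2) :
  K p -> K q -> K r -> side p q r = 1 ->
  0 <= side2 p q x -> 0 <= side2 q r x -> 0 <= side2 r p x ->
  exists s t, [/\ K s, K t & x = s + t].
Proof.
move=> Kp Kq Kr D cr cp cq.
have S : side2 q r x + side2 r p x + side2 p q x = 2.
  have -> : side2 q r x + side2 r p x + side2 p q x = 2 * side p q r.
    by rewrite /side2; crossring.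
  by rewrite D.
have E : x = side2 q r x *: p + side2 r p x *: q + side2 p q x *: r.
  by rewrite -[LHS]scale1r -[X in X *: _]D /side2; vecring.
move: cr cp cq S E; move: (side2 q r x) (side2 r p x) (side2 p q x) => a b c.
move=> c0 a0 b0 S E.
have [[? [? ?]]|[[? [? ?]]|[[? [? ?]]|[[? [? ?]]|[[? [? ?]]|[? [? ?]]]]]]] :
  a = 2 /\ b = 0 /\ c = 0 \/ a = 0 /\ b = 2 /\ c = 0 \/
  a = 0 /\ b = 0 /\ c = 2 \/ a = 1 /\ b = 1 /\ c = 0 \/
  a = 1 /\ b = 0 /\ c = 1 \/ a = 0 /\ b = 1 /\ c = 1 by lia.
all: subst a b c; rewrite E.
- by exists p, p; split=> //; vecring.
- by exists q, q; split=> //; vecring.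
- by exists r, r; split=> //; vecring.
- by exists p, q; split=> //; vecring.
- by exists p, r; split=> //; vecring.
- by exists q, r; split=> //; vecring.
Qed.

(** Induction on the area: an extra lattice point m of the triangle replaces the
    vertex selected by [min_ratio], which keeps x / 2 inside. *)
Lemma triangle_idp (K : set 'rV[int]_2) (p q r x : 'rV[int]_2) :
  lattice_convex K -> K p -> K q -> K r -> 0 < side p q r ->
  0 <= side2 p q x -> 0 <= side2 q r x -> 0 <= side2 r p x ->
  exists s t, [/\ K s, K t & x = s + t].
Proof.
move=> cK.
have [n le] := ubnP `|side p q r|%N.
elim: n p q r le => // n IH p q r le Kp Kq Kr D0 cr cp cq.
have [D1|D1] := leP (side p q r) 1.
  by apply: (unimodular_idp K p q r) => //; lia.
have [m [m1 m2 m3]] := triangle_point p q r D1.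
have mS : side q r m + side r p m + side p q m = side p q r.
  exact: side_sum.
have Km : K m.
  apply: (cK (side q r m) (side r p m) (side p q m) p q r) => //; try lia.
  by rewrite side_sum barycentric.
have [] := min_ratio (side2 q r x) (side2 r p x) (side2 p q x)
  (side q r m) (side r p m) (side p q m); try lia.
- move=> [h h2 h3]; have D' : side m q r = side q r m by crossring.
  have I1 : side p q r * side2 m q x =
      side2 p q x * side q r m - side2 q r x * side p q m.
    by rewrite /side2; crossring.
  have I2 : side p q r * side2 r m x =
      side2 r p x * side q r m - side2 q r x * side r p m.
    by rewrite /side2; crossring.
  apply: (IH m q r) => //; rewrite ?D' //.
  + by clear -le m1 D0; lia.
  + by rewrite -(pmulr_rge0 _ D0) I1 subr_ge0.
  + by rewrite -(pmulr_rge0 _ D0) I2 subr_ge0.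
- move=> [h h1 h3]; have D' : side p m r = side r p m by crossring.
  have I1 : side p q r * side2 p m x =
      side2 p q x * side r p m - side2 r p x * side p q m.
    by rewrite /side2; crossring.
  have I2 : side p q r * side2 m r x =
      side2 q r x * side r p m - side2 r p x * side q r m.
    by rewrite /side2; crossring.
  apply: (IH p m r) => //; rewrite ?D' //.
  + by clear -le m2 D0; lia.
  + by rewrite -(pmulr_rge0 _ D0) I1 subr_ge0.
  + by rewrite -(pmulr_rge0 _ D0) I2 subr_ge0.
- move=> [h h1 h2].
  have I1 : side p q r * side2 q m x =
      side2 q r x * side p q m - side2 p q x * side q r m.
    by rewrite /side2; crossring.
  have I2 : side p q r * side2 m p x =
      side2 r p x * side p q m - side2 p q x * side r p m.
    by rewrite /side2; crossring.
  apply: (IH p q m) => //.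
  + by clear -le m3 D0; lia.
  + by rewrite -(pmulr_rge0 _ D0) I1 subr_ge0.
  + by rewrite -(pmulr_rge0 _ D0) I2 subr_ge0.
Qed.

(** * Lattice points around an interior point *)

(** A further lattice point q of the triangle 0, u, v replaces u or v, according
    to the side of the line through 0 and w on which it lies; the new triangle
    is properly contained in the old one.  If q is on that line, it is opposite
    to w. *)
Lemma shrink_around (K : set 'rV[int]_2) (u v w : 'rV[int]_2) :
  lattice_convex K -> K u -> K v -> K w ->
  1 < cross u v -> 0 < cross v w -> 0 < cross w u ->
  antipodal K \/ exists u' v' w', [/\ K u', K v', K w' &
    [/\ 0 < cross u' v', 0 < cross v' w', 0 < cross w' u' &
    cross u' v' + cross v' w' + cross w' u' <
    cross u v + cross v w + cross w u]].
Proof.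
move=> cK Ku Kv Kw d1 vw wu.
have K0 : K 0.
  apply: (cK (cross v w) (cross w u) (cross u v) u v w) => //; try lia.
  by vecring.
have [q [qv uq sq]] := empty_triangle_point _ _ d1.
have Kq : K q.
  apply: (cK (cross q v) (cross u q) (cross u v - cross q v - cross u q) u v 0)
    => //; try lia.
  by vecring.
have t : cross u v * cross w q = cross q v * cross w u - cross u q * cross v w.
  by crossring.
have pl : cross u q *: w + cross w u *: q = cross w q *: u by vecring.
have [t0|t0|t0] := ltgtP (cross w q) 0.
- right; exists u, q, w; split=> //; rewrite -[cross q w]opprK.
  have -> : - cross q w = cross w q by crossring.
  split; nia.
- right; exists q, v, w; split=> //; split; nia.
- left; apply: (opposite_antipodal K w q (cross u q) (cross w u)) => //.
  + apply/eqP => w0; move: vw; rewrite w0 /cross !mxE !mulr0 subr0; lia.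
  + nia.
  + by rewrite pl t0 scale0r.
Qed.

(** Induction on the area of the triangle u, v, w, the sum of the three
    determinants.  The condition is invariant under rotating u, v, w, so
    [shrink_around] applies as long as one of them exceeds 1. *)
Lemma unimodular_around (K : set 'rV[int]_2) (u v w : 'rV[int]_2) :
  lattice_convex K -> K u -> K v -> K w ->
  0 < cross u v -> 0 < cross v w -> 0 < cross w u ->
  antipodal K \/ exists u' v' w', [/\ K u', K v', K w' &
    [/\ cross u' v' = 1, cross v' w' = 1 & cross w' u' = 1]].
Proof.
move=> cK.
have [n le] := ubnP (absz (cross u v + cross v w + cross w u)).
elim: n u v w le => // n IH u v w le Ku Kv Kw uv vw wu.
have rec : antipodal K \/ (exists u' v' w', [/\ K u', K v', K w' &
    [/\ 0 < cross u' v', 0 < cross v' w', 0 < cross w' u' &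
    cross u' v' + cross v' w' + cross w' u' <
    cross u v + cross v w + cross w u]]) ->
  antipodal K \/ exists u' v' w', [/\ K u', K v', K w' &
    [/\ cross u' v' = 1, cross v' w' = 1 & cross w' u' = 1]].
  move=> [|[u' [v' [w' [? ? ? [? ? ? lt]]]]]]; first by left.
  by apply: (IH u' v' w') => //; lia.
have [uv1|uv1] := ltP 1 (cross u v); first by apply: rec; apply: shrink_around.
have [vw1|vw1] := ltP 1 (cross v w).
  by apply: rec; rewrite -addrA addrC; apply: shrink_around.
have [wu1|wu1] := ltP 1 (cross w u).
  by apply: rec; rewrite addrC addrA; apply: shrink_around.
by right; exists u, v, w; split=> //; split; lia.
Qed.

(** In the basis u, v, the point (1, 1) lies in the triangle with vertices
    (1, 0), (0, 1) and (a, b). *)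
Lemma cone_antipodal (K : set 'rV[int]_2) (u v w : 'rV[int]_2) (a b : int) :
  lattice_convex K -> K u -> K v -> K w -> w != 0 -> u + v + w = 0 ->
  0 < a -> 0 < b -> K (a *: u + b *: v) -> antipodal K.
Proof.
move=> cK Ku Kv Kw w0 s a0 b0 Kz; exists w; split=> //.
have -> : - w = u + v by apply/eqP; rewrite eq_sym -addr_eq0 s.
apply: (cK (b - 1) (a - 1) 1 u v (a *: u + b *: v)) => //; try lia.
by vecring.
Qed.

(** The cones spanned by two of u, v, w cover the plane, so z is either interior
    to one of them, where [cone_antipodal] applies, or on a ray. *)
Lemma unimodular_rays (K : set 'rV[int]_2) (u v w z : 'rV[int]_2) :
  lattice_convex K -> K u -> K v -> K w ->
  cross u v = 1 -> cross v w = 1 -> cross w u = 1 -> K z -> z != 0 ->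
  antipodal K \/
  exists2 y, y \in [:: u; v; w] & exists2 c : int, 0 < c & z = c *: y.
Proof.
move=> cK Ku Kv Kw uv vw wu Kz z0.
have s : u + v + w = 0.
  rewrite -[u]scale1r -[v]scale1r -[w]scale1r -{1}vw -{1}wu -uv; vecring.
have nz (x y : 'rV[int]_2) : cross x y = 1 -> x != 0.
  move=> xy; apply/eqP => x0.
  by move: xy; rewrite x0 /cross !mxE !mul0r subr0; lia.
have zE : z = cross z v *: u + cross u z *: v by rewrite -cramer uv scale1r.
have [u0 v0 w0] := And3 (nz _ _ uv) (nz _ _ vw) (nz _ _ wu).
move: (cross z v) (cross u z) zE => a b zE {uv vw wu}.
have wE : w = - u - v.
  by apply/eqP; rewrite eq_sym -opprD eqr_oppLR -addr_eq0 s.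
have in_cone (x y t : 'rV[int]_2) (c d : int) : x + y + t = 0 ->
    K x -> K y -> K t -> t != 0 -> z = c *: x + d *: y -> 0 < c -> 0 < d ->
    antipodal K.
  move=> xyt Kx Ky Kt t0 zxy c0 d0.
  by apply: (cone_antipodal K x y t c d) => //; rewrite -zxy.
have [b0|b0|b0] := ltgtP b 0.
- have [ab|ab|ab] := ltgtP a b.
  + left; apply: (in_cone v w u (b - a) (- a)) => //; try lia.
    by rewrite addrC addrA.
    by rewrite zE wE; vecring.
  + left; apply: (in_cone w u v (- b) (a - b)) => //; try lia.
    by rewrite -addrA addrC.
    by rewrite zE wE; vecring.
  + right; exists w; first by rewrite !inE eqxx !orbT.
    by exists (- b); [lia | rewrite zE wE ab; vecring].
- have [a0|a0|a0] := ltgtP a 0.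
  + left; apply: (in_cone v w u (b - a) (- a)) => //; try lia.
    by rewrite addrC addrA.
    by rewrite zE wE; vecring.
  + by left; apply: (in_cone u v w a b).
  + right; exists v; first by rewrite !inE eqxx !orbT.
    by exists b => //; rewrite zE a0; vecring.
- have [a0|a0|a0] := ltgtP a 0.
  + left; apply: (in_cone v w u (b - a) (- a)) => //; try lia.
    by rewrite addrC addrA.
    by rewrite zE wE; vecring.
  + right; exists u; first by rewrite !inE eqxx.
    by exists a => //; rewrite zE b0; vecring.
  + by case/eqP: z0; rewrite zE a0 b0; vecring.
Qed.

(** A line through z that leaves the origin strictly on the side of K. *)
Definition supporting (K : set 'rV[int]_2) (z : 'rV[int]_2) :=
  exists n m, [/\ 0 < m, cross n z = - m & forall p, K p -> - m <= cross n p].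

Lemma supporting_ray_inj (K : set 'rV[int]_2) (y : 'rV[int]_2) (c d : int) :
  0 < c -> 0 < d -> K (c *: y) -> K (d *: y) ->
  supporting K (c *: y) -> supporting K (d *: y) -> c = d.
Proof.
have crossZ (n x : 'rV[int]_2) (e : int) : cross n (e *: x) = e * cross n x.
  by crossring.
have le (e f : int) : 0 < e -> 0 < f ->
    K (f *: y) -> supporting K (e *: y) -> f <= e.
  move=> e0 f0 Kf [n [m [m0 nz nK]]].
  have := nK _ Kf; move: nz; rewrite !crossZ; move: (cross n y) => t; nia.
by move=> c0 d0 Kc Kd Sc Sd; apply/eqP; rewrite eq_le !le.
Qed.

(** Without an antipodal pair, the four points would lie on three rays, each of
    which carries at most one of them. *)
Lemma four_supporting_antipodal (K : set 'rV[int]_2) (u v w : 'rV[int]_2)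
  (z : 'I_4 -> 'rV[int]_2) :
  lattice_convex K -> K u -> K v -> K w ->
  0 < cross u v -> 0 < cross v w -> 0 < cross w u ->
  injective z -> (forall j, K (z j)) -> (forall j, supporting K (z j)) ->
  antipodal K.
Proof.
move=> cK Ku Kv Kw uv vw wu zI Kz Sz.
have [//|] := unimodular_around K u v w cK Ku Kv Kw uv vw wu.
move=> {u v w Ku Kv Kw uv vw wu}[u [v [w [Ku Kv Kw [uv vw wu]]]]].
have [//|nA] := EM (antipodal K).
have z0 j : z j != 0.
  apply/eqP => zj0; have [n [m [m0 nz _]]] := Sz j.
  by move: nz; rewrite zj0 /cross !mxE !mulr0 subr0; lia.
have /choice[f fP] : forall j, exists y, y \in [:: u; v; w] /\
    exists2 c : int, 0 < c & z j = c *: y.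
  move=> j; have [//|[y yin yP]] :=
    unimodular_rays K u v w (z j) cK Ku Kv Kw uv vw wu (Kz j) (z0 j).
  by exists y.
have fI : injective f.
  move=> i j fij; apply: zI.
  have [_ [c c0 ci]] := fP i; have [_ [d d0 dj]] := fP j.
  have Ki := Kz i; have Kj := Kz j; have Si := Sz i; have Sj := Sz j.
  rewrite ci in Ki Si *; rewrite dj -fij in Kj Sj *.
  by rewrite (supporting_ray_inj K (f i) c d).
have: (size (codom f) <= size [:: u; v; w])%N.
  apply: uniq_leq_size; first by rewrite codomE map_inj_uniq ?enum_uniq.
  by move=> y /codomP[j ->]; have [] := fP j.
by rewrite size_codom card_ord.
Qed.

(** * Sums of two distinct lattice points *)

(** The point s is moved to the origin.  For s interior, the edge through a
    boundary point z_j becomes a supporting line there. *)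
Lemma nonvertex_midpoint (p q r s : 'rV[int]_2) (z : 'I_4 -> 'rV[int]_2) :
  0 < side p q r -> injective z -> (forall j, triangle p q r (z j)) ->
  (forall j,
     [\/ side p q (z j) = 0, side q r (z j) = 0 | side r p (z j) = 0]) ->
  triangle p q r s -> s != p -> s != q -> s != r ->
  exists g, [/\ g != 0, triangle p q r (s + g) & triangle p q r (s - g)].
Proof.
set K := triangle p q r.
move=> D0 zI Kz zbd Ks sp sq sr.
have cK : lattice_convex K by exact: lattice_convex_triangle.
have [Kp Kq Kr] := triangle_vertices _ _ _ _ D0.
pose K' := [set x | K (s + x)].
have cK' : lattice_convex K' by exact: lattice_convex_translate.
have K'B x : K x -> K' (x - s) by move=> Kx; rewrite /K' /= subrKC.
suff : antipodal K' by [].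
have E : side p q r *: s = side q r s *: p + side r p s *: q + side p q s *: r.
  exact: barycentric.
have S : side q r s + side r p s + side p q s = side p q r by exact: side_sum.
(* A weight 0 would make s the other endpoint; with positive weights, the
   vectors from s to the endpoints are opposite. *)
have edge (x y : 'rV[int]_2) (a b : int) : K x -> K y -> s != x -> s != y ->
    0 <= a -> 0 <= b -> 0 < a + b -> (a + b) *: s = a *: x + b *: y ->
    antipodal K'.
  move=> Kx Ky sx sy a0 b0 ab0 abE.
  have [an|an] := leP a 0.
    have a00 : a = 0 by lia.
    case/eqP: sy; move: abE; rewrite a00 add0r scale0r add0r.
    by apply: scale_rV_inj; lia.
  have [bn|bn] := leP b 0.
    have b00 : b = 0 by lia.
    case/eqP: sx; move: abE; rewrite b00 addr0 scale0r addr0.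
    by apply: scale_rV_inj; lia.
  apply: (opposite_antipodal K' (x - s) (y - s) a b) => //; try exact: K'B.
    by rewrite subr_eq0 eq_sym.
  by rewrite !scalerBr addrACA -abE -opprD -scalerDl subrr.
have [c0 a0 b0] :
  [/\ 0 <= side p q s, 0 <= side q r s & 0 <= side r p s] := Ks.
have [c1|c1] := leP (side p q s) 0.
  have cE : side p q s = 0 by lia.
  apply: (edge p q (side q r s) (side r p s)) => //; try lia.
  by move: E; rewrite -S cE scale0r !addr0.
have [a1|a1] := leP (side q r s) 0.
  have aE : side q r s = 0 by lia.
  apply: (edge q r (side r p s) (side p q s)) => //; try lia.
  by move: E; rewrite -S aE scale0r !add0r.
have [b1|b1] := leP (side r p s) 0.
  have bE : side r p s = 0 by lia.
  apply: (edge p r (side q r s) (side p q s)) => //; try lia.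
  by move: E; rewrite -S bE scale0r !addr0.
have toside (x y t : 'rV[int]_2) : cross (x - t) (y - t) = side x y t.
  by crossring.
apply: (four_supporting_antipodal K' (p - s) (q - s) (r - s)
  (fun j => z j - s)) => //.
- exact: K'B.
- exact: K'B.
- exact: K'B.
- by rewrite toside.
- by rewrite toside.
- by rewrite toside.
- by move=> i j /addIr /zI.
- by move=> j; exact: K'B.
have supp (x y t : 'rV[int]_2) : 0 < side x y s -> side x y t = 0 ->
    (forall k, K k -> 0 <= side x y k) -> supporting K' (t - s).
  (* Relative to s, the side of the line x y is cross (y - x) shifted by the
     side of s itself. *)
  move=> xy0 xyt Kxy; exists (y - x), (side x y s); split=> //.
    have -> : cross (y - x) (t - s) = side x y t - side x y s by crossring.
    by rewrite xyt sub0r.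
  move=> k /Kxy.
  have -> : side x y (s + k) = side x y s + cross (y - x) k by crossring.
  by rewrite addrC -lerBlDr sub0r.
move=> j; have [h|h|h] := zbd j.
- by apply: (supp p q) => // k [].
- by apply: (supp q r) => // k [].
- by apply: (supp r p) => // k [].
Qed.

(** When the decomposition has equal terms, x = s + s, it is replaced by
    (s + g) + (s - g). *)
Lemma distinct_sum_triangle (p q r x : 'rV[int]_2) (z : 'I_4 -> 'rV[int]_2) :
  0 < side p q r -> injective z -> (forall j, triangle p q r (z j)) ->
  (forall j,
     [\/ side p q (z j) = 0, side q r (z j) = 0 | side r p (z j) = 0]) ->
  triangle (2 *: p) (2 *: q) (2 *: r) x ->
  x != 2 *: p -> x != 2 *: q -> x != 2 *: r ->
  exists s t, [/\ s != t, triangle p q r s, triangle p q r t & x = s + t].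
Proof.
move=> D0 zI Tz zbd [cx ax bx] xp xq xr.
have sideM (u v : 'rV[int]_2) :
    0 <= side (2 *: u) (2 *: v) x -> 0 <= side2 u v x.
  have -> : side (2 *: u) (2 *: v) x = 2 * side2 u v x.
    by rewrite /side2; crossring.
  lia.
have cT := lattice_convex_triangle p q r.
have [Tp Tq Tr] := triangle_vertices _ _ _ _ D0.
have [s [t [Ts Tt xst]]] := triangle_idp _ p q r x cT Tp Tq Tr D0
  (sideM _ _ cx) (sideM _ _ ax) (sideM _ _ bx).
have [st|st] := eqVneq s t; last by exists s, t.
subst t; have x2 : x = 2 *: s by rewrite xst; vecring.
have [||||g [g0 Tpg Tmg]] := nonvertex_midpoint p q r s z D0 zI Tz zbd => //.
- by apply: contra xp => /eqP <-; rewrite x2.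
- by apply: contra xq => /eqP <-; rewrite x2.
- by apply: contra xr => /eqP <-; rewrite x2.
exists (s + g), (s - g); split=> //; last by rewrite x2; vecring.
apply: contra g0 => /eqP /addrI gg; apply/eqP.
apply: (@scale_rV_inj _ 2) => //.
have gg0 : g + g = 0 by rewrite {1}gg addNr.
by rewrite scaler0 -gg0; vecring.
Qed.

(** * Triangles in the real plane *)

Lemma convex_setP (R : numDomainType) (M : lmodType R) (A : set M) :
  @convex_set R M A <->
  forall x y (t : R), 0 <= t -> t <= 1 -> A x -> A y ->
    A (t *: x + (1 - t) *: y).
Proof.
split=> [cA x y t t0 t1 Ax Ay|cA x y l].
  by have := cA x y (Itv01 t0 t1); rewrite !inE; apply.
by rewrite !inE => Ax Ay; apply: cA.
Qed.

(** The last two points are merged into their own barycenter y first, unless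
    both of their weights vanish. *)
Lemma convex_set_barycenter (R : numFieldType) (M : lmodType R) (A : set M)
    (a b c : R) (u v w x : M) :
  @convex_set R M A -> 0 <= a -> 0 <= b -> 0 <= c -> 0 < a + b + c ->
  (a + b + c) *: x = a *: u + b *: v + c *: w -> A u -> A v -> A w -> A x.
Proof.
move=> /convex_setP cA a0 b0 c0 s0 E Au Av Aw.
have [bc0|bc] := eqVneq (b + c) 0.
  move/eqP: bc0; rewrite paddr_eq0 // => /andP[/eqP b00 /eqP c00]; subst b c.
  move: s0 E; rewrite !addr0 !scale0r !addr0 => s0.
  by move/(scalerI (lt0r_neq0 s0)) ->.
have bcp : 0 < b + c by rewrite lt0r bc addr_ge0.
have sn0 := lt0r_neq0 s0.
pose y := (b / (b + c)) *: v + (1 - b / (b + c)) *: w.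
have Ay : A y.
  apply: cA => //; first by rewrite divr_ge0 // ltW.
  by rewrite ler_pdivrMr // mul1r lerDl.
have -> : x = (a / (a + b + c)) *: u + (1 - a / (a + b + c)) *: y.
  apply: (scalerI sn0); rewrite E scalerDr /y !scalerDr !scalerA -addrA.
  congr (_ *: _ + (_ *: _ + _ *: _)); field.
  - exact: sn0.
  - by rewrite bc sn0.
  - by rewrite bc sn0.
apply: cA => //; first by rewrite divr_ge0 // ltW.
by rewrite ler_pdivrMr // mul1r -addrA lerDl addr_ge0.
Qed.

(** Barycentric coordinates are the signed areas divided by the area of the
    triangle, hence nonnegative on the three half-planes. *)
Lemma conv_hull_triangle (R : realType) (p q r : 'rV[R]_2) :
  0 < side p q r -> conv_hull [set p; q; r] = triangle p q r.
Proof.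
move=> D0.
have [Tp Tq Tr] := triangle_vertices _ _ _ _ D0.
apply/seteqP; split=> [|x [c0 a0 b0] A [cA VA]].
  apply: smallest_sub.
    apply/convex_setP => x y t t0 t1 [x1 x2 x3] [y1 y2 y3].
    have half (u v : 'rV[R]_2) : 0 <= side u v x -> 0 <= side u v y ->
        0 <= side u v (t *: x + (1 - t) *: y).
      move=> X Y; have -> : side u v (t *: x + (1 - t) *: y) =
          t * side u v x + (1 - t) * side u v y by crossring.
      by rewrite addr_ge0 // mulr_ge0 // subr_ge0.
    by split; apply: half.
  by move=> _ [[->|->]|->].
have S : side q r x + side r p x + side p q x = side p q r by exact: side_sum.
apply: (@convex_set_barycenter R 'rV[R]_2 A
  (side q r x) (side r p x) (side p q x) p q r) => //.
- by rewrite S.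
- by rewrite S; exact: barycentric.
- by apply: VA; left; left.
- by apply: VA; left; right.
- by apply: VA; right.
Qed.

Lemma half_triangle (R : realType) (p q r : 'rV[R]_2) :
  [set 2^-1 *: x | x in triangle (2 *: p) (2 *: q) (2 *: r)] = triangle p q r.
Proof.
have sideM (u v x : 'rV[R]_2) : side (2 *: u) (2 *: v) (2 *: x) = 4 * side u v x.
  by crossring.
have h x : triangle (2 *: p) (2 *: q) (2 *: r) (2 *: x) <-> triangle p q r x.
  by rewrite /triangle /= !sideM !pmulr_rge0.
have n2 : (2 : R) != 0 by rewrite pnatr_eq0.
apply/seteqP; split=> [_ [x Tx <-]|x Tx].
  by apply/h; rewrite scalerA divff // scale1r.
by exists (2 *: x); [apply/h | rewrite scalerA mulVf // scale1r].
Qed.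

Lemma side_continuous (R : realType) (p q : 'rV[R]_2) : continuous (side p q).
Proof.
move=> x; rewrite /side /cross.
have c j : {for x, continuous (fun y : 'rV[R]_2 => (y - p) 0 j)}.
  rewrite (_ : (fun y => _) = fun y : 'rV[R]_2 => y 0 j - p 0 j); last first.
    by apply/funext => y; rewrite !mxE.
  by apply: continuousB; [exact: coord_continuous | exact: cst_continuous].
have cM k j : {for x, continuous (fun y : 'rV[R]_2 => k * (y - p) 0 j)}.
  by apply: continuousM; [exact: cst_continuous | exact: c].
exact: (@continuousB R R^o _ (fun y : 'rV[R]_2 => (q - p) 0 0 * (y - p) 0 1)
  (fun y : 'rV[R]_2 => (q - p) 0 1 * (y - p) 0 0) x (cM _ 1) (cM _ 0)).
Qed.

(** The triangle is closed, and the points strictly inside all three half-planes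
    form an open subset of it. *)
Lemma boundary_triangle (R : realType) (p q r x : 'rV[R]_2) :
  boundary (triangle p q r) x ->
  triangle p q r x /\ [\/ side p q x = 0, side q r x = 0 | side r p x = 0].
Proof.
have E : triangle p q r = side p q @^-1` [set y | 0 <= y] `&`
    (side q r @^-1` [set y | 0 <= y] `&` side r p @^-1` [set y | 0 <= y]).
  by apply/seteqP; split=> [y []|y [? []]].
have cl : closed (triangle p q r).
  have clh (u v : 'rV[R]_2) : closed (side u v @^-1` [set y | 0 <= y]).
    apply: preimage_closed; last exact: closed_ge.
    by move=> y _; exact: side_continuous.
  by rewrite E; apply: closedI; last apply: closedI.
pose U := side p q @^-1` [set y | 0 < y] `&`
    (side q r @^-1` [set y | 0 < y] `&` side r p @^-1` [set y | 0 < y]).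
have oU : open U.
  have oph (u v : 'rV[R]_2) : open (side u v @^-1` [set y | 0 < y]).
    apply: open_comp; last exact: open_gt.
    by move=> y _; exact: side_continuous.
  by apply: openI; last apply: openI.
have UT : U `<=` interior (triangle p q r).
  rewrite -open_subsetE //.
  by move=> y [/ltW ? [/ltW ? /ltW ?]].
rewrite /boundary -((closure_id _).1 cl) => -[Tx nint].
split=> //; have [c0 a0 b0] := Tx.
have [|c1] := eqVneq (side p q x) 0; first by constructor 1.
have [|a1] := eqVneq (side q r x) 0; first by constructor 2.
have [|b1] := eqVneq (side r p x) 0; first by constructor 3.
exfalso; apply: nint; apply: UT.
by split; [|split]; rewrite /= lt0r ?c1 ?a1 ?b1.
Qed.

Lemma side_map (R : realType) (p q x : 'rV[int]_2) :
  side (map_mx intr p) (map_mx intr q) (map_mx intr x) = (side p q x)%:~R :> R.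
Proof. by rewrite /side /cross !mxE !rmorphB !rmorphM !rmorphB. Qed.

Lemma triangle_map (R : realType) (p q r x : 'rV[int]_2) :
  triangle (map_mx intr p) (map_mx intr q) (map_mx intr r)
    (map_mx intr x : 'rV[R]_2) <-> triangle p q r x.
Proof. by rewrite /triangle /= !side_map !ler0z. Qed.

Lemma map_intr_inj (R : realType) (n : nat) :
  injective (fun x : 'rV[int]_n => map_mx intr x : 'rV[R]_n).
Proof.
move=> x y /rowP E; apply/rowP => i; have := E i; rewrite !mxE; exact: intr_inj.
Qed.

(** * H-simplices *)

(** The set of all lattice points of the hull is mediated; it therefore is the
    maximal mediated set. *)
Lemma H_simplex_triangle (R : realType) (p q r : 'rV[int]_2) :
  let f (x : 'rV[int]_2) : 'rV[R]_2 := map_mx intr x in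
  let V := [set 2 *: f p; 2 *: f q; 2 *: f r] in
  0 < side p q r ->
  `I_4 #<= boundary [set 2^-1 *: x | x in conv_hull V] `&` lattice R 2 ->
  H_simplex V.
Proof.
move=> f V D0.
have fM (x : 'rV[int]_2) : 2 *: f x = f (2 *: x).
  by apply/rowP => i; rewrite !mxE rmorphM.
have D20 : 0 < side (2 *: f p) (2 *: f q) (2 *: f r).
  rewrite !fM /f side_map ltr0z.
  have -> : side (2 *: p) (2 *: q) (2 *: r) = 4 * side p q r by crossring.
  by rewrite pmulr_rgt0.
rewrite (conv_hull_triangle _ _ _ _ D20) half_triangle.
move=> /pcard_leP[g].
have gP (j : 'I_4) : exists y,
    g j = f y /\ boundary (triangle (f p) (f q) (f r)) (f y).
  have : (boundary (triangle (f p) (f q) (f r)) `&` lattice R 2) (g j).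
    by apply: (@funS _ _ _ _ g); exact: ltn_ord.
  by move=> [gb [y _ gy]]; exists y; rewrite -/(f y) in gy *; rewrite gy.
have /choice[z zP] := gP.
have zI : injective z.
  move=> i j zij; apply/val_inj/(@inj _ _ _ g); rewrite ?inE; try exact: ltn_ord.
  exact: etrans (zP i).1 (etrans (congr1 f zij) (esym (zP j).1)).
have zT j : triangle p q r (z j) /\
    [\/ side p q (z j) = 0, side q r (z j) = 0 | side r p (z j) = 0].
  have [/triangle_map ? bd] := boundary_triangle _ _ _ _ _ (zP j).2; split=> //.
  move: bd; rewrite /f !side_map.
  by case=> /eqP; rewrite intr_eq0 => /eqP;
    [constructor 1 | constructor 2 | constructor 3].
have mem x : conv_hull V (f x) <-> triangle (2 *: p) (2 *: q) (2 *: r) x.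
  by rewrite conv_hull_triangle // !fM; exact: triangle_map.
have mem2 x : conv_hull V (f (2 *: x)) <-> triangle p q r x.
  rewrite mem /triangle /=.
  have sideM (u v : 'rV[int]_2) :
      side (2 *: u) (2 *: v) (2 *: x) = 4 * side u v x.
    by crossring.
  by rewrite !sideM !pmulr_rge0.
have VL : V `<=` conv_hull V `&` lattice R 2.
  move=> x Vx; split; first exact: sub_gen_smallest.
  by case: Vx => [[->|->]|->]; rewrite fM; eexists.
apply/seteqP; split=> [x [L [LZ _ _] Lx]|]; first exact: LZ.
apply: (max_mediatedP _).2; first by move=> x /VL[].
split=> // x [xV [y _ yx]]; rewrite -/(f y) in yx; subst x.
have [|yV] := pselect (V (f y)); first by right.
left; split; first by exists y.
have nv u : V (2 *: f u) -> y != 2 *: u.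
  by move=> Vu; apply/eqP => yu; apply: yV; rewrite yu -fM.
have [|||s [t [st Ts Tt yst]]] := distinct_sum_triangle p q r y z D0 zI
    (fun j => (zT j).1) (fun j => (zT j).2) ((mem y).1 xV).
- by apply: nv; left; left.
- by apply: nv; left; right.
- by apply: nv; right.
exists (2 *: f s), (2 *: f t); split.
- move=> E; case/eqP: st; apply: (@map_intr_inj R); apply: scalerI E.
  by rewrite pnatr_eq0.
- split; last by exists (f s) => //; exists s.
  by rewrite fM; split; [apply/mem2 | exists (2 *: s)].
- split; last by exists (f t) => //; exists t.
  by rewrite fM; split; [apply/mem2 | exists (2 *: t)].
- by rewrite -scalerDr scalerA mulVf ?pnatr_eq0 // scale1r yst /f map_mxD.
Qed.

(** Full rank gives B with B M = 1.  The first row of M vanishes, so taking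
    determinants exhibits 1 as a multiple of the area. *)
Lemma affine_dim2_side_neq0 (R : realType) (a : 'I_3 -> 'rV[R]_2) :
  affine_dim a = 2%N -> side (a 0) (a 1) (a 2%:R) != 0.
Proof.
rewrite /affine_dim; set M := \matrix_(i < 3) _ => rM.
have /row_fullP[B BM] : row_full M by rewrite /row_full rM.
have E i j :
    B i 1 * (a 1 - a 0) 0 j + B i 2%:R * (a 2%:R - a 0) 0 j = (i == j)%:R.
  have := congr1 (fun A : 'M[R]_2 => A i j) BM.
  rewrite !mxE !big_ord_recl big_ord0 !mxE addr0 => <-.
  have -> : lift ord0 ord0 = 1 :> 'I_3 by apply: val_inj.
  have -> : lift ord0 (lift ord0 ord0) = 2%:R :> 'I_3 by apply: val_inj.
  by rewrite subrr mulr0 add0r.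
apply/eqP => S0.
pose e i j := B i 1 * (a 1 - a 0) 0 j + B i 2%:R * (a 2%:R - a 0) 0 j.
have : e 0 0 * e 1 1 - e 0 1 * e 1 0 = 1.
  by rewrite /e !E /= mulr1 mul0r subr0.
have -> : e 0 0 * e 1 1 - e 0 1 * e 1 0 =
    (B 0 1 * B 1 2%:R - B 0 2%:R * B 1 1) * side (a 0) (a 1) (a 2%:R).
  by rewrite /e; crossring.
by rewrite S0 mulr0 => /esym/eqP; rewrite oner_eq0.
Qed.

(** Exchanging two vertices reverses the sign of the area, so the vertices may
    be taken in counterclockwise order. *)
Theorem corollary5p10 (R : realType) (a : 'I_3 -> 'rV[R]_2)
  (ha : forall i, even_nat_lattice R 2 (a i))
  (hdim : affine_dim a = 2%N)
  (hbd : `I_4 #<=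
     boundary [set 2^-1 *: x | x in conv_hull (range a)] `&` lattice R 2) :
  H_simplex (range a).
Proof.
have /choice[b ab] : forall i, exists y : 'rV[int]_2, a i = 2 *: map_mx intr y.
  move=> i; have [k _ <-] := ha i; exists (map_mx Posz k).
  by congr (_ *: _); apply/rowP => j; rewrite !mxE.
have rangeE : range a = [set a 0; a 1; a 2%:R].
  apply/seteqP; split=> [_ [i _ <-]|_ [[->|->]|->]];
    [|by exists 0|by exists 1|by exists 2%:R].
  case: i => -[|[|[|//]]] i3.
  - by left; left; congr a; apply: val_inj.
  - by left; right; congr a; apply: val_inj.
  - by right; congr a; apply: val_inj.
have S : side (b 0) (b 1) (b 2%:R) != 0.
  apply: contra (affine_dim2_side_neq0 R a hdim) => /eqP S0.
  have -> : side (a 0) (a 1) (a 2%:R) = 4 * (side (b 0) (b 1) (b 2%:R))%:~R.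
    by rewrite -side_map !ab; crossring.
  by rewrite S0 mulr0.
move: hbd; rewrite rangeE !ab.
have [S0|S0|S0] := ltgtP (side (b 0) (b 1) (b 2%:R)) 0.
- rewrite -setUA [X in _ `|` X]setUC setUA; apply: H_simplex_triangle.
  have -> : side (b 0) (b 2%:R) (b 1) = - side (b 0) (b 1) (b 2%:R) by crossring.
  by rewrite oppr_gt0.
- exact: H_simplex_triangle.
- by rewrite S0 eqxx in S.
Qed.
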